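(* Let $\mathfrak{A}$ be a unital $C^*$-algebra, $a\in\mathfrak{A}$ a nonzero positive element, $t,s\ge 0$ real numbers with $t+s>0$, and let $x\in\mathfrak{A}_a$. Then: (i) $v_{(a,(t,s))}(x)=\sup_{\alpha,\beta\in\mathbb{R},\ \alpha^2+\beta^2=1}\left\|\alpha\,\mathfrak{R}_{(t,s)}(x)+\beta\,\mathfrak{I}_{(t,s)}(x)\right\|_a$. (ii) $v_{(a,(t,s))}(x)=\frac12\sup_{\theta,\varphi\in\mathbb{R}}\left\|\mathfrak{R}_{(t,s)}\left((e^{i\theta}-ie^{i\varphi})x\right)\right\|_a$.
   Context: $\mathcal{S}(\mathfrak{A})$ is the set of states of $\mathfrak{A}$ and $\mathcal{S}_a(\mathfrak{A})=\{f/f(a): f\in\mathcal{S}(\mathfrak{A}),\ f(a)\ne 0\}$. For $x\in\mathfrak{A}$, $\|x\|_a=\sup\{\sqrt{f(x^*ax)}: f\in\mathcal{S}_a(\mathfrak{A})\}\in[0,\infty]$. An element $x^{\sharp_a}\in\mathfrak{A}$ is an $a$-adjoint of $x$ if $ax^{\sharp_a}=x^*a$; $\mathfrak{A}_a$ is the set of all elements of $\mathfrak{A}$ admitting an $a$-adjoint (a subalgebra of $\mathfrak{A}$ on which $\|\cdot\|_a$ is a finite semi-norm). $a$-adjoints need not be unique; $x^{\sharp_a}$ denotes an $a$-adjoint of $x$, with $(\lambda x)^{\sharp_a}=\overline{\lambda}x^{\sharp_a}$ for $\lambda\in\mathbb{C}$; the quantities in the claim do not depend on the choice. For $x\in\mathfrak{A}_a$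 put $\mathfrak{R}_{(t,s)}(x)=tx+sx^{\sharp_a}$, $\mathfrak{I}_{(t,s)}(x)=t(-ix)+s(-ix)^{\sharp_a}$, and $v_{(a,(t,s))}(x)=\sup_{\theta\in\mathbb{R}}\|\mathfrak{R}_{(t,s)}(e^{i\theta}x)\|_a$. *)

(* Defs.v *)
From HB Require Import structures.
From mathcomp Require Import all_boot all_order all_algebra.
From mathcomp Require Import complex.
From mathcomp Require Import all_classical all_reals all_analysis.

Set Implicit Arguments.
Unset Strict Implicit.
Unset Printing Implicit Defensive.

Import Order.TTheory GRing.Theory Num.Theory.

Local Open Scope classical_set_scope.
Local Open Scope ring_scope.
Local Open Scope complex_scope.

(* The norm is a field of the structure and completeness is spelled out with
   Cauchy sequences: Hierarchy-Builder rejects a join of [completeNormedModType]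
   with [algType] declared after [numDomainType]. *)
HB.mixin Record isCstarAlgebra (R : realType) A of GRing.Algebra R[i] A := {
  star : A -> A ;
  cnorm : A -> R ;
  starK : involutive star ;
  starD : {morph star : x y / x + y} ;
  starZ : forall (c : R[i]) (x : A), star (c *: x) = (c^*)%C *: star x ;
  starM : forall x y : A, star (x * y) = star y * star x ;
  cnorm_eq0 : forall x : A, cnorm x = 0 -> x = 0 ;
  cnormD : forall x y : A, cnorm (x + y) <= cnorm x + cnorm y ;
  cnormZ : forall (c : R[i]) (x : A), cnorm (c *: x) = Normc.normc c * cnorm x ;
  cnormM : forall x y : A, cnorm (x * y) <= cnorm x * cnorm y ;
  cnorm_star : forall x : A, cnorm (star x * x) = cnorm x ^+ 2 ;
  cnorm_complete : forall u : nat -> A,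
    (forall e : R, 0 < e -> exists N : nat,
       forall m n : nat, (N <= m)%N -> (N <= n)%N -> cnorm (u m - u n) < e) ->
    exists l : A, forall e : R, 0 < e -> exists N : nat,
       forall n : nat, (N <= n)%N -> cnorm (u n - l) < e
}.

#[short(type="cstarAlgType")]
HB.structure Definition CstarAlgebra (R : realType) :=
  {A of isCstarAlgebra R A & GRing.Algebra R[i] A}.

Section CstarDefs.
Variables (R : realType) (A : cstarAlgType R).
Implicit Types (a x y z : A) (t s : R) (f : A -> R[i]) (sharp : A -> A).

Definition positive a := exists b, a = star b * b.

(* The order of [R[i]] is partial: [0 <= z] says that [z] is real and
   nonnegative. *)
Definition positive_functional f := forall y, positive y -> 0 <= f y.

Definition functional_norm f : \bar R :=
  ereal_sup [set (Normc.normc (f y))%:E | y in [set y | cnorm y <= 1]].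

Definition state (f : {scalar A}) :=
  positive_functional f /\ functional_norm f = 1%E.

Definition states_at a : set (A -> R[i]) :=
  [set (fun y => f y / f a) | f in [set f : {scalar A} | state f /\ f a != 0]].

Definition anorm a x : \bar R :=
  ereal_sup [set (Num.sqrt (complex.Re (f (star x * a * x))))%:E | f in states_at a].

Definition is_adjoint a x y := a * y = star x * a.

Definition adjointable a : set A := [set x | exists y, is_adjoint a x y].

(* [sharp] is a selection of [a]-adjoints on [adjointable a] (its values
   elsewhere are irrelevant), compatible with scalar multiplication. *)
Definition adjoint_selection a sharp :=
  (forall x, adjointable a x -> is_adjoint a x (sharp x)) /\
  (forall (c : R[i]) x, adjointable a x -> sharp (c *: x) = (c^*)%C *: sharp x).

Definition weighted_re sharp t s x := t%:C *: x + s%:C *: sharp x.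

Definition weighted_im sharp t s x :=
  t%:C *: (- 'i%C *: x) + s%:C *: sharp (- 'i%C *: x).

Definition expi (theta : R) : R[i] := cos theta +i* sin theta.

Definition weighted_radius a sharp t s x : \bar R :=
  ereal_sup [set anorm a (weighted_re sharp t s (expi theta *: x))
            | theta in [set: R]].

Lemma adjoint_scale a x y (c : R[i]) :
  is_adjoint a x y -> is_adjoint a (c *: x) ((c^*)%C *: y).
Proof. by rewrite /is_adjoint starZ -scalerAr -scalerAl => ->. Qed.

(* A selection as above always exists, so quantifying over all of them is not
   vacuous: fix one representative and one of its [a]-adjoints on each complex
   line. *)
Lemma exists_adjoint_selection a : exists sharp, adjoint_selection a sharp.
Proof.
pose line x : set A := [set y | exists2 c : R[i], c != 0 & y = c *: x].
have lineP x : line x x by exists 1; rewrite ?oner_neq0 ?scale1r.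
have lineE x (c : R[i]) : c != 0 -> line (c *: x) = line x.
  move=> c0; apply/seteqP; split=> y [d d0 ->].
    by exists (d * c); rewrite ?mulf_neq0 ?scalerA.
  by exists (d / c); rewrite ?mulf_neq0 ?invr_eq0// scalerA divfK.
pose r x := xget 0 (line x).
have rP x : line x (r x) by apply: (@xgetPex _ 0 (line x)); exists x.
pose k x : R[i] := xget 0 [set c : R[i] | x = c *: r x].
have kP x : x = k x *: r x.
  apply: (@xgetPex _ 0 [set c : R[i] | x = c *: r x]).
  have [c c0 e] := rP x; exists c^-1 => /=.
  by rewrite e scalerA mulVf // scale1r.
pose s x := xget 0 [set y | is_adjoint a x y].
pose sh x := if x == 0 then 0 else ((k x)^*)%C *: s (r x).
have shP x : adjointable a x -> is_adjoint a x (sh x).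
  rewrite /sh; have [->|_ ax] := eqVneq x 0.
    have star0 : star (0 : A) = 0.
      by rewrite -[X in star X](scale0r 0) starZ rmorph0 scale0r.
    by rewrite /is_adjoint star0 mul0r mulr0.
  suff: is_adjoint a (k x *: r x) ((k x)^*%C *: s (r x)) by rewrite -kP.
  apply: adjoint_scale; apply: (@xgetPex _ 0 [set y | is_adjoint a (r x) y]).
  have [c c0 ->] := rP x; have [y ay] := ax.
  by exists ((c^*)%C *: y); apply: adjoint_scale.
exists sh; split=> // c x ax; rewrite /sh.
have Z0 : 0 *: x = 0 := scale0r x.
have [->|c0] := eqVneq c 0; first by rewrite Z0 eqxx rmorph0 scale0r.
have [->|x0] := eqVneq x 0.
  by rewrite [c *: 0]scaler0; case: eqP => // _; rewrite scaler0.
rewrite scaler_eq0 (negbTE c0) (negbTE x0) /=.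
have re : r (c *: x) = r x by rewrite /r lineE.
suff -> : k (c *: x) = c * k x by rewrite re rmorphM scalerA.
have r0 : r x != 0 by apply: contraNneq x0 => r0; rewrite (kP x) r0 scaler0.
apply/eqP; rewrite -subr_eq0.
have /eqP : (k (c *: x) - c * k x) *: r x = 0.
  by rewrite scalerBl -[in X in X - _]re -kP -scalerA -kP subrr.
by rewrite scaler_eq0 (negbTE r0) orbF.
Qed.

End CstarDefs.

(* Main.v *)
(* For c = r e^(i psi) with r >= 0, R_(t,s)(c x) = r R_(t,s)(e^(i psi) x), so
   ||R_(t,s)(c x)||_a <= |c| v(x). For (i),
   alpha R_(t,s)(x) + beta I_(t,s)(x) = R_(t,s)((alpha - i beta) x), and
   alpha - i beta runs over the unit circle. For (ii),
   |e^(i theta) - i e^(i phi)| <= 2, and this number equals 2 e^(i theta) when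
   phi = theta + pi / 2. *)
Require Import Defs.
From HB Require Import structures.
From mathcomp Require Import all_boot all_order all_algebra.
From mathcomp Require Import complex.
From mathcomp Require Import all_classical all_reals all_analysis.
From mathcomp Require Import ring.

Import Order.TTheory GRing.Theory Num.Theory.

Local Open Scope classical_set_scope.
Local Open Scope ring_scope.

(** The angle [acos u] has cosine [u] and sine [|v|]; the sign of [v] decides between it and its
    opposite. *)
Lemma circle_cos_sin {R : realType} (u v : R) :
  u ^+ 2 + v ^+ 2 = 1 -> exists theta, u = cos theta /\ v = sin theta.
Proof.
move=> uv; have u1 : -1 <= u <= 1.
  have u2 : u ^+ 2 <= 1 by rewrite -uv lerDl sqr_ge0.
  by rewrite -ler_norml -(@expr_le1 _ 2) // -normrX ger0_norm ?sqr_ge0.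
have sE : sin (acos u) = `|v|.
  by rewrite sin_acos // -uv addrAC subrr add0r sqrtr_sqr.
have [v0|v0] := leP 0 v.
  by exists (acos u); rewrite acosK ?in_itv//= sE ger0_norm.
exists (- acos u).
by rewrite cosN sinN acosK ?in_itv//= sE ltr0_norm ?opprK.
Qed.

Lemma complex_polar {R : realType} (c : R[i]) :
  exists theta, c = (Normc.normc c)%:C%C * expi theta.
Proof.
(* The angle is read off [c / |c|], so [c = 0] is treated apart; any angle serves there. *)
have [->|c0] := eqVneq c 0.
  by exists 0; rewrite Normc.normc0 mul0r.
case: c c0 => u v c0; set r := Normc.normc _.
have r0 : r != 0 by apply: contra_neq c0; exact: Normc.eq0_normc.
have r2 : r ^+ 2 = u ^+ 2 + v ^+ 2 by rewrite sqr_sqrtr // addr_ge0 ?sqr_ge0.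
have [|theta [ctheta stheta]] := @circle_cos_sin R (u / r) (v / r).
  by rewrite !expr_div_n -mulrDl -r2 divff // expf_neq0.
exists theta; rewrite /expi -ctheta -stheta.
by apply/eqP; rewrite eq_complex /= !mul0r subr0 addr0 !(mulrC r) !divfK ?eqxx.
Qed.

Lemma normc_expi {R : realType} (theta : R) : Normc.normc (expi theta) = 1.
Proof. by rewrite /= cos2Dsin2 sqrtr1. Qed.

Lemma normc_expi_sub_le2 {R : realType} (theta phi : R) :
  Normc.normc (expi theta - 'i%C * expi phi) <= 2.
Proof.
apply: le_trans (le_normcD _ _) _.
by rewrite normcN Normc.normcM !normc_expi /= expr0n expr1n add0r sqrtr1 mul1r.
Qed.

Lemma expiD_pihalf {R : realType} (theta : R) :
  expi (theta + pi / 2) = 'i%C * expi theta.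
Proof.
rewrite /expi cosDpihalf sinDpihalf; apply/eqP.
by rewrite eq_complex /= !mul0r !mul1r !add0r !eqxx.
Qed.

Section Anorm.
Context {R : realType} {A : cstarAlgType R}.
Implicit Types (a x y : A) (f : A -> R[i]).

Lemma states_at_sqrt_realZ a f (r : R) y : states_at a f -> 0 <= r ->
  Num.sqrt (complex.Re (f (star (r%:C%C *: y) * a * (r%:C%C *: y)))) =
  r * Num.sqrt (complex.Re (f (star y * a * y))).
Proof.
move=> [g _ <-] r0; rewrite starZ conjc_real -!scalerAl -scalerAr scalerA.
rewrite -rmorphM linearZ /= -mulrA.
(* The nonnegative factor [r * r] splits off the square root whatever the sign of [p]. *)
case: (_ / _) => p q /=; rewrite mul0r subr0 sqrtrM ?mulr_ge0 // -expr2.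
by rewrite sqrtr_sqr ger0_norm.
Qed.

(* Bounding r by k > 0 allows r = 0, where the equality below would require
   [states_at a] to be nonempty: otherwise [anorm a] is constantly -oo. *)
Lemma anorm_realZ_le a (r k : R) y : 0 <= r <= k -> 0 < k ->
  (anorm a (r%:C%C *: y) <= k%:E * anorm a y)%E.
Proof.
move=> /andP[r0 rk] k0; apply: ge_ereal_sup => _ [f fa <-].
rewrite states_at_sqrt_realZ //.
set c := Num.sqrt _; apply: (@le_trans _ _ (k%:E * c%:E)%E).
  by rewrite -EFinM lee_fin ler_wpM2r ?sqrtr_ge0.
by rewrite lee_pmul2l // ereal_sup_ubound //; exists f.
Qed.

(** The reverse inequality is [anorm_realZ_le] with factor [r^-1], applied to [r y]. *)
Lemma anorm_realZ a (r : R) y : 0 < r ->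
  anorm a (r%:C%C *: y) = (r%:E * anorm a y)%E.
Proof.
move=> r0; apply/eqP; rewrite eq_le anorm_realZ_le ?lexx ?(ltW r0) //=.
have yE : y = (r^-1)%:C%C *: (r%:C%C *: y).
  by rewrite scalerA -rmorphM mulVf ?gt_eqF // scale1r.
rewrite -lee_pdivlMl // [in leLHS]yE.
by rewrite anorm_realZ_le ?invr_gt0 // lexx invr_ge0 ltW.
Qed.

Section Selection.
Context {a : A} {sharp : A -> A} (sharpP : adjoint_selection a sharp).
Context {x : A} (ax : adjointable a x) (t s : R).

Lemma weighted_reZ (c : R[i]) : weighted_re sharp t s (c *: x) =
  (t%:C%C * c) *: x + (s%:C%C * (c^*)%C) *: sharp x.
Proof. by rewrite /weighted_re sharpP.2 // !scalerA. Qed.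

(** Since [sharp] is conjugate-homogeneous, a scalar comes out of both terms alike when it is its
    own conjugate. *)
Lemma weighted_re_realZ (r : R) (c : R[i]) :
  weighted_re sharp t s ((r%:C%C * c) *: x) =
  r%:C%C *: weighted_re sharp t s (c *: x).
Proof.
rewrite !weighted_reZ.
have -> : ((r%:C%C * c)^*)%C = r%:C%C * (c^*)%C.
  by rewrite -[in RHS](conjc_real r) -rmorphM.
by rewrite scalerDr !scalerA !(mulrCA r%:C%C).
Qed.

Lemma weighted_re_im_comb (u v : R) :
  u%:C%C *: weighted_re sharp t s x + v%:C%C *: weighted_im sharp t s x =
  weighted_re sharp t s ((u -i* v)%C *: x).
Proof.
(* With [x] as [1 *: x] and the imaginary part as the real part of [- 'i *: x], both sides are
   combinations of [x] and [sharp x], whose coefficients are compared. *)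
have := weighted_reZ 1; rewrite scale1r => ->.
rewrite -[weighted_im _ _ _ _]/(weighted_re sharp t s (- 'i%C *: x)).
rewrite !weighted_reZ !scalerDr !scalerA addrACA -!scalerDl.
congr (_ *: _ + _ *: _); apply/eqP; rewrite eq_complex /=;
  apply/andP; split; apply/eqP; ring.
Qed.

(** The phase of [c] is one of the angles in the supremum, so only its modulus has to be bounded; a
    positive [k] also covers [c = 0]. *)
Lemma anorm_weighted_re_le (c : R[i]) (k : R) : Normc.normc c <= k -> 0 < k ->
  (anorm a (weighted_re sharp t s (c *: x)) <=
   k%:E * weighted_radius a sharp t s x)%E.
Proof.
move=> ck k0; have [theta cE] := complex_polar c.
rewrite [in leLHS]cE weighted_re_realZ.
apply: le_trans (anorm_realZ_le _ _ k _ _ k0) _.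
  by rewrite ck andbT; case: c {cE ck} => p q; rewrite sqrtr_ge0.
by rewrite lee_pmul2l // ereal_sup_ubound //; exists theta.
Qed.

End Selection.
End Anorm.

Theorem theorem2p5 (R : realType) (A : cstarAlgType R) (a : A)
    (a_pos : positive a) (a_neq0 : a != 0)
    (t s : R) (t_ge0 : 0 <= t) (s_ge0 : 0 <= s) (ts_gt0 : 0 < t + s)
    (sharp : A -> A) (sharpP : adjoint_selection a sharp)
    (x : A) (ax : adjointable a x) :
  weighted_radius a sharp t s x =
    ereal_sup [set anorm a (p.1%:C%C *: weighted_re sharp t s x
                            + p.2%:C%C *: weighted_im sharp t s x)
              | p in [set p : R * R | p.1 ^+ 2 + p.2 ^+ 2 = 1]]
  /\
  weighted_radius a sharp t s x =
    ((2^-1)%:E * ereal_sup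
      [set anorm a (weighted_re sharp t s
                      ((expi p.1 - 'i%C * expi p.2) *: x))
      | p in [set: R * R]])%E.
Proof.
split.
  congr ereal_sup; apply/seteqP; split=> [_ [theta _ <-]|_ [[u v] /= uv <-]].
    (* The pair [(u, v)] stands for the scalar [u - i v], hence the minus sign. *)
    exists (cos theta, - sin theta) => /=; first by rewrite sqrrN cos2Dsin2.
    by rewrite (weighted_re_im_comb sharpP ax) opprK.
  have [|theta [-> vE]] := @circle_cos_sin R u (- v); first by rewrite sqrrN.
  by exists theta => //; rewrite (weighted_re_im_comb sharpP ax) /expi -vE.
apply/eqP; rewrite eq_le; apply/andP; split.
  apply: ge_ereal_sup => _ [theta _ <-].
  (* The factor 2, moved to the left, is absorbed into the scalar, giving [2 e^(i theta)], which a
     pair of angles attains. *)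
  rewrite lee_pdivlMl // -anorm_realZ // -(weighted_re_realZ sharpP ax).
  apply: ereal_sup_ubound; exists (theta, theta + pi / 2) => //=.
  by rewrite expiD_pihalf mulrA -expr2 sqr_i mulN1r opprK rmorphD mulrDl mul1r.
rewrite lee_pdivrMl //; apply: ge_ereal_sup => _ [[theta phi] _ <-].
by apply: anorm_weighted_re_le => //; exact: normc_expi_sub_le2.
Qed.
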